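(* Let $D\colon\mathbf{J}\to\mathbf{C}$ be a functor into a balanced dagger category $\mathbf{C}$ that admits polar decomposition. Suppose that $D$ has a limit $l_A\colon L\to D(A)$ such that $l_A^\dagger l_A l_B^\dagger l_B=l_B^\dagger l_B l_A^\dagger l_A$ for all $A$ and $B$ in some weakly initial class $\Omega$ of objects of $\mathbf{J}$. Then there is a functor $E\colon\mathbf{J}\to\mathbf{C}$ naturally isomorphic to $D$ such that $(E,\Omega)$ has a dagger limit.
   Context: A dagger category is a category $\mathbf{C}$ equipped with an identity-on-objects functor $\dagger\colon\mathbf{C}^{\mathrm{op}}\to\mathbf{C}$ satisfying $f^{\dagger\dagger}=f$. A morphism $f$ is a partial isometry if $f=ff^\dagger f$; an endomorphism $f$ is self-adjoint if $f=f^\dagger$; a bimorphism is a morphism that is both monic and epic. A category is balanced if all its bimorphisms are isomorphisms. A polar decomposition of $f\colon A\to B$ consists of two factorizations $f=pi=jp$ where $p\colon A\to B$ is a partial isometry and $i\colon A\to A$, $j\colon B\to B$ are self-adjoint bimorphisms. A dagger category admits polar decomposition if every morphism has a polar decomposition. A class $\Omega$ of objects of $\mathbf{J}$ is weakly initial if every object of $\mathbf{J}$ receives a morphism from some object in $\Omega$. A dagger limit of $(E,\Omega)$ is a limit $(L,e_A\colon L\to E(A))$ of $E$ such that $e_A$ is a partial isometry for all $A\in\Omega$ and $e_A^\dagger e_A e_B^\dagger e_B=e_B^\dagger e_B e_A^\dagger e_A$ for all $A,B\in\Omega$. *)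

(* Defs.v *)
Set Implicit Arguments.
Unset Strict Implicit.
Unset Printing Implicit Defensive.

Declare Scope cat_scope.
Delimit Scope cat_scope with cat.

(* [comp g f] is [g] after [f]; hom-types carry Leibniz equality. *)
Record category : Type := Category {
  ob :> Type;
  hom : ob -> ob -> Type;
  idm : forall A : ob, hom A A;
  comp : forall A B X : ob, hom B X -> hom A B -> hom A X;
  comp1m : forall (A B : ob) (f : hom A B), comp (idm B) f = f;
  compm1 : forall (A B : ob) (f : hom A B), comp f (idm A) = f;
  compA : forall (A B X Y : ob) (h : hom X Y) (g : hom B X) (f : hom A B),
    comp h (comp g f) = comp (comp h g) f
}.

Arguments hom {c} A B.
Arguments idm {c} A.
Arguments comp {c A B X} g f.

Notation "g ∘ f" := (comp g f) (at level 40, left associativity) : cat_scope.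
Local Open Scope cat_scope.

Record functor (J C : category) : Type := Functor {
  fob :> J -> C;
  fmap : forall A B : J, hom A B -> hom (fob A) (fob B);
  fmap1 : forall A : J, fmap (idm A) = idm (fob A);
  fmapM : forall (A B X : J) (g : hom B X) (f : hom A B),
    fmap (g ∘ f) = fmap g ∘ fmap f
}.

Arguments fmap {J C} f {A B} u : rename.

Section CategoryNotions.
Variable C : category.

Definition monic (A B : C) (f : hom A B) : Prop :=
  forall (X : C) (u v : hom X A), f ∘ u = f ∘ v -> u = v.

Definition epic (A B : C) (f : hom A B) : Prop :=
  forall (X : C) (u v : hom B X), u ∘ f = v ∘ f -> u = v.

Definition bimorphism (A B : C) (f : hom A B) : Prop := monic f /\ epic f.

Definition isomorphism (A B : C) (f : hom A B) : Prop :=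
  exists g : hom B A, g ∘ f = idm A /\ f ∘ g = idm B.

Definition balanced : Prop :=
  forall (A B : C) (f : hom A B), bimorphism f -> isomorphism f.

Definition weakly_initial (Omega : C -> Prop) : Prop :=
  forall B : C, exists A : C, Omega A /\ inhabited (hom A B).

End CategoryNotions.

Section Limits.
Variables J C : category.

Definition is_cone (D : functor J C) (L : C) (l : forall A : J, hom L (D A)) :
    Prop :=
  forall (A B : J) (f : hom A B), fmap D f ∘ l A = l B.

Definition is_limit (D : functor J C) (L : C) (l : forall A : J, hom L (D A)) :
    Prop :=
  is_cone l /\
  forall (M : C) (m : forall A : J, hom M (D A)), is_cone m ->
    exists! u : hom M L, forall A : J, l A ∘ u = m A.

Definition naturally_isomorphic (E D : functor J C) : Prop :=
  exists eta : forall A : J, hom (E A) (D A),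
    (forall (A B : J) (f : hom A B), eta B ∘ fmap E f = fmap D f ∘ eta A) /\
    (forall A : J, isomorphism (eta A)).

End Limits.

Record dagger_category : Type := DaggerCategory {
  dcat :> category;
  dagger : forall A B : dcat, hom A B -> hom B A;
  dagger1 : forall A : dcat, dagger (idm A) = idm A;
  daggerM : forall (A B X : dcat) (g : hom B X) (f : hom A B),
    dagger (g ∘ f) = dagger f ∘ dagger g;
  daggerK : forall (A B : dcat) (f : hom A B), dagger (dagger f) = f
}.

Arguments dagger {d A B} f.

Notation "f †" := (dagger f) (at level 1, left associativity, format "f †") :
  cat_scope.

Section DaggerNotions.
Variable C : dagger_category.

Definition partial_isometry (A B : C) (f : hom A B) : Prop := f = f ∘ f† ∘ f.

Definition self_adjoint (A : C) (f : hom A A) : Prop := f = f†.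

Definition polar_decomposition (A B : C) (f p : hom A B) (i : hom A A)
    (j : hom B B) : Prop :=
  f = p ∘ i /\ f = j ∘ p /\ partial_isometry p /\
  (self_adjoint i /\ bimorphism i) /\ (self_adjoint j /\ bimorphism j).

Definition admits_polar_decomposition : Prop :=
  forall (A B : C) (f : hom A B),
    exists (p : hom A B) (i : hom A A) (j : hom B B),
      polar_decomposition f p i j.

Definition commuting_on (J : category) (D : functor J C) (Omega : J -> Prop)
    (L : C) (l : forall A : J, hom L (D A)) : Prop :=
  forall A B : J, Omega A -> Omega B ->
    (l A)† ∘ l A ∘ (l B)† ∘ l B = (l B)† ∘ l B ∘ (l A)† ∘ l A.

(* [Omega] is meant to be weakly initial; this is not part of the predicate. *)
Definition is_dagger_limit (J : category) (E : functor J C)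
    (Omega : J -> Prop) (L : C) (e : forall A : J, hom L (E A)) : Prop :=
  is_limit e /\
  (forall A : J, Omega A -> partial_isometry (e A)) /\
  commuting_on Omega e.

End DaggerNotions.

(* Main.v *)
From Stdlib Require Import IndefiniteDescription.
Require Import Defs.

(** Choose for every object [A] of the indexing category a polar decomposition
    [l A = p A ∘ i A = j A ∘ p A].  In a balanced category the bimorphism [j A]
    is invertible, so [D] can be conjugated by the family [j]: the functor [E]
    has the objects of [D] and sends [f : A -> B] to
    [(j B)⁻¹ ∘ D f ∘ j A].  Then [j] is a natural isomorphism from [E] to [D],
    and its inverse carries the limit cone [l] to the limit cone [(j A)⁻¹ ∘ l A = p A],
    all of whose legs are partial isometries.

    What remains is that the projections [p†p] of the legs commute whenever the
    endomorphisms [l†l] do.  The projection [p†p] commutes with [i], hence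
    [l†l = p†p i²] with [i²] epic.  This makes [p†p] a support of [l†l], so
    everything self-adjoint that commutes with [l†l] also commutes with [p†p]
    ([support_commutes]).  Applying this once to each of two legs turns the
    commutation of [lA†lA] with [lB†lB] first into that of [pA†pA] with [lB†lB]
    and then into that of [pA†pA] with [pB†pB]. *)

Set Implicit Arguments.
Unset Strict Implicit.
Unset Printing Implicit Defensive.

Local Open Scope cat_scope.

Section Conjugation.
Variables (J C : category) (D : functor J C).
Variables (X : J -> C) (s : forall A, hom (X A) (D A))
          (t : forall A, hom (D A) (X A)).
Hypothesis ts : forall A, t A ∘ s A = idm (X A).
Hypothesis st : forall A, s A ∘ t A = idm (D A).

Definition conj_fmap (A B : J) (f : hom A B) : hom (X A) (X B) :=
  t B ∘ fmap D f ∘ s A.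

Lemma conj_fmap1 A : conj_fmap (idm A) = idm (X A).
Proof. unfold conj_fmap. now rewrite fmap1, compm1, ts. Qed.

Lemma conj_fmapM (A B Y : J) (g : hom B Y) (f : hom A B) :
  conj_fmap (g ∘ f) = conj_fmap g ∘ conj_fmap f.
Proof.
  unfold conj_fmap. rewrite fmapM, !compA.
  now rewrite <- (compA (t Y ∘ fmap D g) (s B)), st, compm1.
Qed.

Definition conj_functor : functor J C := Functor conj_fmap1 conj_fmapM.

Lemma conj_functor_iso : naturally_isomorphic conj_functor D.
Proof.
  exists s. split.
  - intros A B f. simpl. unfold conj_fmap.
    now rewrite !compA, st, comp1m.
  - intros A. exists (t A). now split.
Qed.

(** A cone over the conjugate corresponds to a cone over [D] by composing its
    legs with [s], so universality transfers. *)
Lemma conj_functor_limit (L : C) (l : forall A, hom L (D A)) :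
  is_limit l -> is_limit (D := conj_functor) (fun A => t A ∘ l A).
Proof.
  intros [cone_l univ_l]. split.
  - intros A B f. simpl. unfold conj_fmap.
    rewrite compA, <- (compA (t B ∘ fmap D f) (s A)), st, compm1.
    now rewrite <- compA, cone_l.
  - intros M m cone_m.
    destruct (univ_l M (fun A => s A ∘ m A)) as [u [lu uniq_u]].
    { intros A B f. rewrite <- (cone_m A B f). simpl. unfold conj_fmap.
      now rewrite !compA, st, comp1m. }
    exists u. split.
    + intros A. now rewrite <- compA, lu, compA, ts, comp1m.
    + intros v tlv. apply uniq_u. intros A.
      now rewrite <- tlv, !compA, st, comp1m.
Qed.

End Conjugation.

Lemma epic_comp (C : category) (A B X : C) (g : hom B X) (f : hom A B) :
  epic g -> epic f -> epic (g ∘ f).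
Proof.
  intros epi_g epi_f Y u v uv. apply epi_g, epi_f.
  now rewrite <- !compA.
Qed.

Section Commutation.
Variable C : dagger_category.

(** From [h = q a] the idempotent [q] fixes [h], so [x h = h x = q h x = q x h];
    cancelling [a] gives [x q = q x q], whose right side is self-adjoint. *)
Lemma support_commutes (L : C) (q a x : hom L L) :
  self_adjoint q -> q ∘ q = q -> epic a -> self_adjoint x ->
  q ∘ a ∘ x = x ∘ (q ∘ a) -> q ∘ x = x ∘ q.
Proof.
  unfold self_adjoint. intros q_sa q_idem epi_a x_sa comm.
  assert (xq : x ∘ q = q ∘ x ∘ q).
  { apply epi_a.
    rewrite <- compA, <- comm, <- !compA, (compA x q a), <- (compA x q a).
    rewrite <- comm, !compA. now rewrite q_idem. }
  transitivity ((x ∘ q)†).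
  - now rewrite daggerM, <- q_sa, <- x_sa.
  - now rewrite xq, !daggerM, <- q_sa, <- x_sa, compA, <- xq.
Qed.

Lemma gram_self_adjoint (A B : C) (f : hom A B) : self_adjoint (f† ∘ f).
Proof. unfold self_adjoint. now rewrite daggerM, daggerK. Qed.

Lemma partial_isometry_idem (A B : C) (p : hom A B) :
  partial_isometry p -> p† ∘ p ∘ (p† ∘ p) = p† ∘ p.
Proof.
  intros p_pi. rewrite <- compA, (compA p). now rewrite <- p_pi.
Qed.

(** The two factorizations together make [p†p] commute with [i]:
    [p†p i = p† j p] is self-adjoint. *)
Lemma polar_gram (A B : C) (f p : hom A B) (i : hom A A) (j : hom B B) :
  polar_decomposition f p i j -> f† ∘ f = p† ∘ p ∘ (i ∘ i).
Proof.
  intros [f_pi [f_jp [_ [[i_sa _] [j_sa _]]]]].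
  unfold self_adjoint in i_sa, j_sa.
  assert (comm : i ∘ (p† ∘ p) = p† ∘ p ∘ i).
  { transitivity ((p† ∘ p ∘ i)†).
    - now rewrite !daggerM, daggerK, <- i_sa.
    - now rewrite <- compA, <- f_pi, f_jp, !daggerM, daggerK, <- j_sa, compA. }
  rewrite f_pi, daggerM, <- i_sa.
  now rewrite compA, <- (compA i), comm, compA.
Qed.

Lemma polar_support_commutes (A B : C) (f p : hom A B) (i x : hom A A)
    (j : hom B B) :
  polar_decomposition f p i j -> self_adjoint x ->
  f† ∘ f ∘ x = x ∘ (f† ∘ f) -> p† ∘ p ∘ x = x ∘ (p† ∘ p).
Proof.
  intros f_polar x_sa.
  rewrite (polar_gram f_polar).
  destruct f_polar as [_ [_ [p_pi [[_ [_ epi_i]] _]]]].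
  apply support_commutes; trivial.
  - apply gram_self_adjoint.
  - now apply partial_isometry_idem.
  - now apply epic_comp.
Qed.

End Commutation.

(** The data of a polar decomposition whose left factor is inverted, bundled so
    that one application of choice provides all of it for every leg. *)
Record polar_data (C : dagger_category) (A B : C) : Type := PolarData {
  polar_p : hom A B;
  polar_i : hom A A;
  polar_j : hom B B;
  polar_jinv : hom B B
}.

Lemma balanced_polar (C : dagger_category) (A B : C) (f : hom A B) :
  balanced C -> admits_polar_decomposition C ->
  exists d : polar_data A B,
    polar_decomposition f (polar_p d) (polar_i d) (polar_j d) /\
    polar_jinv d ∘ polar_j d = idm B /\ polar_j d ∘ polar_jinv d = idm B.
Proof.
  intros C_balanced C_polar.
  destruct (C_polar A B f) as [p [i [j f_polar]]].
  pose proof f_polar as [_ [_ [_ [_ [_ j_bi]]]]].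
  destruct (C_balanced B B j j_bi) as [k [kj jk]].
  exists (PolarData p i j k). now split.
Qed.

Theorem theorem8p10 (J : category) (C : dagger_category) (D : functor J C)
    (Omega : J -> Prop) (L : C) (l : forall A : J, hom L (D A))
    (C_balanced : balanced C)
    (C_polar : admits_polar_decomposition C)
    (Omega_weakly_initial : weakly_initial Omega)
    (l_limit : is_limit l)
    (l_comm : commuting_on Omega l) :
  exists E : functor J C,
    naturally_isomorphic E D /\
    exists (M : C) (e : forall A : J, hom M (E A)),
      is_dagger_limit Omega e.
Proof.
  pose (d := fun A => proj1_sig (constructive_indefinite_description _
               (balanced_polar (l A) C_balanced C_polar))).
  assert (dP : forall A,
    polar_decomposition (l A) (polar_p (d A)) (polar_i (d A)) (polar_j (d A)) /\
    polar_jinv (d A) ∘ polar_j (d A) = idm (D A) /\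
    polar_j (d A) ∘ polar_jinv (d A) = idm (D A)).
  { intros A. unfold d. apply proj2_sig. }
  pose (p := fun A => polar_p (d A)).
  assert (ts : forall A, polar_jinv (d A) ∘ polar_j (d A) = idm (D A))
    by (intros A; apply dP).
  assert (st : forall A, polar_j (d A) ∘ polar_jinv (d A) = idm (D A))
    by (intros A; apply dP).
  assert (leg : forall A, polar_jinv (d A) ∘ l A = p A).
  { intros A. destruct (dP A) as [[_ [l_jp _]] _].
    now rewrite l_jp, compA, ts, comp1m. }
  exists (conj_functor ts st). split; [apply conj_functor_iso |].
  exists L, (fun A => polar_jinv (d A) ∘ l A).
  split; [now apply conj_functor_limit | split].
  - intros A _. change (partial_isometry (polar_jinv (d A) ∘ l A)).
    rewrite leg. now destruct (dP A) as [[_ [_ [p_pi _]]] _].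
  - intros A B OA OB. simpl. rewrite !leg.
    rewrite <- (compA _ _ (p B)), <- (compA _ _ (p A)).
    apply (polar_support_commutes (proj1 (dP A)));
      [apply gram_self_adjoint | symmetry].
    apply (polar_support_commutes (proj1 (dP B)));
      [apply gram_self_adjoint |].
    rewrite !compA. now apply l_comm.
Qed.
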